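(* For a natural number $n\ge 2$ put $\Gamma(n) = \frac12\left(\frac{1}{\lfloor n/2\rfloor}+\frac{1}{\lceil n/2\rceil}\right)$, and for $n\ge 3$ and real $\mathfrak{D}>1$ put $\zeta(n,\mathfrak{D}) = \ln\bigl(\frac{1}{1-\Gamma(n)}\bigr)/\ln\mathfrak{D}$; also set $\zeta(n,1)=+\infty$ (with $[0,\zeta]=[0,\zeta)=[0,\infty)$ in that case). Then: (i) For every finite semi-metric space $(X,d)$ with $n=|X|\geq 2$, the (normalized) $0$-negative type gap is $\Gamma_X^0 = \Gamma(n)$. (ii) Every finite semi-metric space $(X,d)$ with $n=|X|\geq 3$ and scaled diameter $\mathfrak{D}$ has $p$-negative type for all $p\in[0,\zeta(n,\mathfrak{D})]$ and strict $p$-negative type for all $p\in[0,\zeta(n,\mathfrak{D}))$. (iii) The value $\zeta(n,\mathfrak{D})$ is always optimal for finite semi-metric spaces: for each natural number $n\ge 3$ and each real $\mathfrak{D}>1$ there exists an $n$-point semi-metric space of scaled diameter $\mathfrak{D}$ whose maximal $p$-negative type is exactly $\zeta(n,\mathfrak{D})$.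
   Context: A semi-metric $d$ on a set $X$ satisfies all the axioms of a metric except possibly the triangle inequality. The scaled diameter of a finite semi-metric space $(X,d)$ with at least two points is $\mathfrak{D}=\max_{x,y\in X} d(x,y)/\min\{d(x,y): x\neq y\}$. Convention for exponent $p=0$: $d(x,y)^0 = 1$ if $x\neq y$, and $d(x,x)^0=0$. Let $p\ge 0$ and let $(X,d)$ be a semi-metric space. (a) $(X,d)$ has $p$-negative type if for all natural numbers $k \geq 2$, all finite subsets $\{x_1,\ldots,x_k\} \subseteq X$ (of $k$ distinct points), and all real numbers $\eta_1,\ldots,\eta_k$ with $\eta_1+\cdots+\eta_k = 0$, one has $\sum_{1\le i,j\le k} d(x_i,x_j)^p\eta_i\eta_j \leq 0$. (b) $(X,d)$ has strict $p$-negative type if it has $p$-negative type and the inequalities in (a) are all strict except when $(\eta_1,\ldots,\eta_k)=(0,\ldots,0)$. The maximal $p$-negative type of $(X,d)$ is $\max\{p\ge 0: (X,d)\text{ has }p\text{-negative type}\}$. For positive integers $q,t$, a normalized $(q,t)$-simplex $D(\vec\omega)=[a_j(m_j);b_i(n_i)]_{q,t}$ in $X$ consists of $q+t$ distinct points $a_1,\ldots,a_q,b_1,\ldots,b_t\in X$ together with a vector $\vec\omega=(m_1,\ldots,m_q,n_1,\ldots,n_t)$ of (strictly) positive real numbers such that $m_1+\cdots+m_q = 1 = n_1+\cdots+n_t$. Its $p$-negative type simplex gap is $$\gamma_D^p(\vec\omega) = \sum_{j=1}^{q}\sum_{i=1}^{t} m_j n_i d(a_j,b_i)^p - \sum_{1\le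 j_1<j_2\le q} m_{j_1}m_{j_2}d(a_{j_1},a_{j_2})^p - \sum_{1\le i_1<i_2\le t} n_{i_1}n_{i_2}d(b_{i_1},b_{i_2})^p.$$ Sums over the empty set are zero. If $(X,d)$ has $p$-negative type, its (normalized) $p$-negative type gap is $\Gamma_X^p = \inf_{D(\vec\omega)} \gamma_D^p(\vec\omega)$, the infimum being over all $q,t\ge1$ and all normalized $(q,t)$-simplices in $X$. Every semi-metric space has $0$-negative type, so $\Gamma_X^0$ is defined. *)

(* Defs.v *)
From HB Require Import structures.
From mathcomp Require Import all_boot all_order all_algebra.
From mathcomp Require Import all_classical all_reals all_analysis.

Set Implicit Arguments.
Unset Strict Implicit.
Unset Printing Implicit Defensive.

Import Order.TTheory GRing.Theory Num.Theory.

Local Open Scope classical_set_scope.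
Local Open Scope ring_scope.

Definition semimetric (R : realType) (X : Type) (d : X -> X -> R) : Prop :=
  [/\ forall x y, 0 <= d x y,
      forall x y, d x y = 0 <-> x = y &
      forall x y, d x y = d y x].

(* d(x,y)^p, with the convention d(x,x)^0 = 0; powR alone would give
   0 `^ 0 = 1. *)
Definition dist_pow (R : realType) (X : eqType) (d : X -> X -> R) (p : R)
    (x y : X) : R :=
  if p == 0 then (x != y)%:R else d x y `^ p.

Definition negative_form (R : realType) (X : eqType) (d : X -> X -> R) (p : R)
    (k : nat) (x : 'I_k -> X) (eta : 'I_k -> R) : R :=
  \sum_(i < k) \sum_(j < k) dist_pow d p (x i) (x j) * eta i * eta j.

Definition negative_type (R : realType) (X : eqType) (d : X -> X -> R) (p : R)
    : Prop :=
  forall (k : nat) (x : 'I_k -> X) (eta : 'I_k -> R),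
    (2 <= k)%N -> injective x -> \sum_(i < k) eta i = 0 ->
    negative_form d p x eta <= 0.

Definition strict_negative_type (R : realType) (X : eqType) (d : X -> X -> R)
    (p : R) : Prop :=
  negative_type d p /\
  forall (k : nat) (x : 'I_k -> X) (eta : 'I_k -> R),
    (2 <= k)%N -> injective x -> \sum_(i < k) eta i = 0 ->
    ~ (forall i, eta i = 0) ->
    negative_form d p x eta < 0.

(* The value is extended real so that it can be compared with zeta below; the
   maximum, when it exists, is attained at a finite p. *)
Definition is_maximal_negative_type (R : realType) (X : eqType)
    (d : X -> X -> R) (z : \bar R) : Prop :=
  let S : set (\bar R) := [set p%:E | p in [set p | 0 <= p /\ negative_type d p]]
  in S z /\ ubound S z.

Record simplex (R : realType) (X : eqType) (q t : nat) := Simplex {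
  spa : 'I_q -> X;
  spb : 'I_t -> X;
  swa : 'I_q -> R;
  swb : 'I_t -> R;
  spa_inj : injective spa;
  spb_inj : injective spb;
  spab_neq : forall j i, spa j <> spb i;
  swa_gt0 : forall j, 0 < swa j;
  swb_gt0 : forall i, 0 < swb i;
  swa_sum1 : \sum_(j < q) swa j = 1;
  swb_sum1 : \sum_(i < t) swb i = 1 }.

Definition simplex_gap (R : realType) (X : eqType) (d : X -> X -> R) (p : R)
    (q t : nat) (D : simplex R X q t) : R :=
  \sum_(j < q) \sum_(i < t)
      swa D j * swb D i * dist_pow d p (spa D j) (spb D i)
  - \sum_(j1 < q) \sum_(j2 < q | (j1 < j2)%N)
      swa D j1 * swa D j2 * dist_pow d p (spa D j1) (spa D j2)
  - \sum_(i1 < t) \sum_(i2 < t | (i1 < i2)%N)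
      swb D i1 * swb D i2 * dist_pow d p (spb D i1) (spb D i2).

Definition negative_type_gap (R : realType) (X : eqType) (d : X -> X -> R)
    (p : R) : \bar R :=
  ereal_inf [set g | exists (q t : nat) (D : simplex R X q t),
    [/\ (1 <= q)%N, (1 <= t)%N & g = (simplex_gap d p D)%:E]].

(* The starting value 0 is harmless because distances are nonnegative. *)
Definition diameter (R : realType) (X : finType) (d : X -> X -> R) : R :=
  \big[Num.max/0]_(x : X) \big[Num.max/0]_(y : X) d x y.

(* Starting the minimum at the diameter does not change it as soon as X has two
   points. *)
Definition min_distance (R : realType) (X : finType) (d : X -> X -> R) : R :=
  \big[Num.min/diameter d]_(xy : X * X | xy.1 != xy.2) d xy.1 xy.2.

Definition scaled_diameter (R : realType) (X : finType) (d : X -> X -> R) : R :=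
  diameter d / min_distance d.

Definition Gamma_n (R : realType) (n : nat) : R :=
  2^-1 * ((n./2)%:R^-1 + (uphalf n)%:R^-1).

Definition zeta (R : realType) (n : nat) (D : R) : \bar R :=
  if D == 1 then +oo%E else (ln (1 / (1 - Gamma_n R n)) / ln D)%:E.

(* Main.v *)
Require Import Defs.
From HB Require Import structures.
From mathcomp Require Import all_boot all_order all_algebra.
From mathcomp Require Import all_classical all_reals all_analysis.
From mathcomp Require Import zify ring lra.

Set Implicit Arguments.
Unset Strict Implicit.
Unset Printing Implicit Defensive.

Import Order.TTheory GRing.Theory Num.Theory.

Local Open Scope classical_set_scope.
Local Open Scope ring_scope.

(** For weights [eta] of sum zero on at most [n] points, applying Cauchy-Schwarz
    separately to the positive and to the nonpositive weights gives
    [sum eta^2 >= Gamma(n)/2 * (sum |eta|)^2].  Bounding [d^p] by the p-th power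
    of the diameter on pairs of equal signs and of the least distance on pairs
    of opposite signs, the quadratic form is at most
    [(diam^p * (1 - Gamma(n)) - min^p)/2 * (sum |eta|)^2], which is nonpositive
    exactly when [p <= zeta].  All these inequalities are equalities for two
    blocks of sizes [n/2] and [n - n/2], uniform weights, distance [D] inside
    the blocks and [1] across.  For [p = 0] the gap of a simplex is
    [(sum m^2 + sum n^2)/2], minimised by the same Cauchy-Schwarz argument. *)

(** * Bounds on the constant [Gamma_n] *)

Lemma Gamma_nE (R : realType) n :
  2 * Gamma_n R n = (n./2)%:R^-1 + (uphalf n)%:R^-1.
Proof. by rewrite /Gamma_n mulVKf ?pnatr_eq0. Qed.

Lemma Gamma_n_gt0 (R : realType) n : (2 <= n)%N -> 0 < Gamma_n R n.
Proof.
move=> n2; have : 0 < 2 * Gamma_n R n.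
  by rewrite Gamma_nE addr_gt0 ?invr_gt0 ?ltr0n; lia.
by rewrite pmulr_rgt0.
Qed.

(** The value at [n = 2] is 1; from [n = 3] on, the larger half is at least 2, so [1 - Gamma_n] is
    positive and its logarithm is meaningful. *)
Lemma Gamma_n_lt1 (R : realType) n : (3 <= n)%N -> Gamma_n R n < 1.
Proof.
move=> n3; have := Gamma_nE R n.
have : (n./2)%:R^-1 <= 1 :> R by rewrite invf_le1 ?ler1n ?ltr0n; lia.
have : (uphalf n)%:R^-1 <= 2^-1 :> R by rewrite lef_pV2 ?posrE ?ltr0n ?ler_nat; lia.
lra.
Qed.

(* The difference of the two sides is (a - q)(b - q), nonnegative for every
   integer q because a and b differ by at most 1. *)
Lemma leq_mul_balanced (a b q r : nat) :
  (q + r = a + b)%N -> (a <= b <= a.+1)%N -> (q * r <= a * b)%N.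
Proof.
move=> qr /andP[ab ba]; have [qa|aq] := leqP q a.
  have [u [-> ->]] : exists u, a = (q + u)%N /\ r = (b + u)%N by exists (a - q)%N; lia.
  nia.
have [u [-> ->]] : exists u, q = (b + u)%N /\ a = (r + u)%N by exists (q - b)%N; lia.
nia.
Qed.

(** Raising [t] to [n - q] only lowers the right side, which is then [n / (q * (n - q))]; the
    balanced split maximises the denominator. *)
Lemma Gamma_n_le (R : realType) (q t n : nat) :
  (0 < q)%N -> (0 < t)%N -> (q + t <= n)%N ->
  2 * Gamma_n R n <= q%:R^-1 + t%:R^-1.
Proof.
move=> q0 t0 qtn; rewrite Gamma_nE.
have t'0 : (0 < n - q)%N by lia.
apply: (@le_trans _ _ (q%:R^-1 + (n - q)%:R^-1)); last first.
  by rewrite lerD2l lef_pV2 ?posrE ?ltr0n ?ler_nat //; lia.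
have invD (u v : nat) : (0 < u)%N -> (0 < v)%N ->
    u%:R^-1 + v%:R^-1 = (u + v)%:R / (u * v)%:R :> R.
  move=> u0 v0; rewrite natrD natrM; field.
  by rewrite !pnatr_eq0 -!lt0n u0 v0.
rewrite !invD //; try lia.
rewrite (_ : n./2 + uphalf n = n)%N; last by lia.
rewrite (_ : q + (n - q) = n)%N; last by lia.
rewrite ler_wpM2l // lef_pV2 ?posrE ?ltr0n ?ler_nat ?muln_gt0; try lia.
by apply: leq_mul_balanced; lia.
Qed.

(** * Cauchy-Schwarz and quadratic forms in weights of sum zero *)

Lemma sumr_cst_inv (R : realType) k : (0 < k)%N -> \sum_(i < k) k%:R^-1 = 1 :> R.
Proof. by move=> k0; rewrite sumr_const card_ord -[LHS]mulr_natl divff ?pnatr_eq0 -?lt0n. Qed.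

(** Cauchy-Schwarz, from the nonnegativity of the squared deviations from the mean; for empty [A]
    the left side is 0 because the inverse of 0 is 0. *)
Lemma sqr_sum_le (R : realType) (I : finType) (A : pred I) (f : I -> R) :
  (\sum_(i | A i) f i) ^+ 2 / #|A|%:R <= \sum_(i | A i) f i ^+ 2.
Proof.
set s := \sum_(i | A i) f i.
have [->|q0] := eqVneq #|A| 0%N; first by rewrite invr0 mulr0 sumr_ge0 // => i _; apply: sqr_ge0.
set q : R := #|A|%:R; have q0' : q != 0 by rewrite pnatr_eq0.
have : 0 <= \sum_(i | A i) (f i - s / q) ^+ 2 by apply: sumr_ge0 => i _; apply: sqr_ge0.
rewrite (eq_bigr (fun i => f i ^+ 2 - (2 * (s / q)) * f i + (s / q) ^+ 2));
  last by move=> i _; ring.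
rewrite big_split sumrB /= -mulr_sumr -/s sumr_const -[_ *+ #|_|]mulr_natl -/q.
have -> : q * (s / q) ^+ 2 = s ^+ 2 / q by field.
have -> : 2 * (s / q) * s = 2 * (s ^+ 2 / q) by ring.
lra.
Qed.

Lemma sqr_sumr_norm_le (R : realType) (I : finType) (n : nat) (f : I -> R) :
  (#|I| <= n)%N -> \sum_i f i = 0 ->
  Gamma_n R n / 2 * (\sum_i `|f i|) ^+ 2 <= \sum_i f i ^+ 2.
Proof.
move=> In f0; pose A := [pred i | 0 < f i].
rewrite (bigID A) [X in _ <= X](bigID A) /=; move: f0; rewrite (bigID A) /=.
rewrite [X in (X + _) ^+ 2](eq_bigr f) => [|i /gtr0_norm //].
rewrite [X in (_ + X) ^+ 2](eq_bigr (fun i => - f i)); last first.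
  by move=> i; rewrite -leNgt => /ler0_norm.
rewrite sumrN; set s := \sum_(i | 0 < f i) f i; set s' := \sum_(i | ~~ _) f i => ss'.
have {ss'} s'E : s' = - s by lra.
have sP : s ^+ 2 / #|A|%:R <= \sum_(i | 0 < f i) f i ^+ 2 := sqr_sum_le A f.
have : s' ^+ 2 / #|predC A|%:R <= \sum_(i | ~~ (0 < f i)) f i ^+ 2 := sqr_sum_le (predC A) f.
rewrite s'E sqrrN => sN.
(* Here the sum of absolute values is [2 * s]. A nonzero [s] forces both sign classes to be
   nonempty, as [Gamma_n_le] requires. *)
have [s0|s0] := eqVneq s 0.
  by rewrite s0 oppr0 subrr expr0n mulr0 addr_ge0 ?sumr_ge0 // => i _; apply: sqr_ge0.
have A0 : (0 < #|A|)%N.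
  rewrite lt0n; apply: contra_neq s0 => /card0_eq A_0.
  by apply: big_pred0 => i; have := A_0 i; rewrite inE.
have A'0 : (0 < #|predC A|)%N.
  rewrite lt0n; apply: contra_neq s0 => /card0_eq A_0.
  apply/eqP; rewrite -oppr_eq0 -s'E; apply/eqP.
  by apply: big_pred0 => i; have := A_0 i; rewrite inE.
have := @Gamma_n_le R _ _ n A0 A'0; rewrite cardC => /(_ In) /(ler_wpM2r (sqr_ge0 s)).
rewrite mulrDl; lra.
Qed.

(* Equality holds when the weight [c] is [hi] on pairs of equal signs
   and [lo] on pairs of opposite signs. *)
Lemma weighted_product_le (R : realType) (lo hi c x y : R) : lo <= c <= hi ->
  c * x * y <= (hi - lo) / 2 * (`|x| * `|y|) + (hi + lo) / 2 * (x * y).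
Proof.
move=> /andP[loc chi]; rewrite -normrM -mulrA; move: (x * y) => z.
by have [z0|z0] := ger0P z; nra.
Qed.

(** The mixed product term sums to zero with [f]. The last term cancels the majorant on the
    diagonal, where it equals [hi * f i ^+ 2] but the coefficients of interest vanish. *)
Lemma sum_majorant (R : realType) (I : finType) (lo hi : R) (f : I -> R) :
  \sum_i f i = 0 ->
  \sum_i \sum_j ((hi - lo) / 2 * (`|f i| * `|f j|) + (hi + lo) / 2 * (f i * f j)
                 - (i == j)%:R * (hi * f i ^+ 2))
  = (hi - lo) / 2 * (\sum_i `|f i|) ^+ 2 - hi * \sum_i f i ^+ 2.
Proof.
move=> f0.
rewrite (eq_bigr (fun i => (hi - lo) / 2 * (`|f i| * \sum_j `|f j|) - hi * f i ^+ 2)).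
  by rewrite sumrB -!mulr_sumr -mulr_suml expr2.
move=> i _; rewrite sumrB big_split /= -!mulr_sumr f0 !mulr0 addr0; congr (_ - _).
rewrite (bigD1 i) //= eqxx mul1r big1 ?addr0 // => j ji.
by rewrite eq_sym (negbTE ji) mul0r.
Qed.

Lemma two_valued_form_le (R : realType) (I : finType) (n : nat) (lo hi : R)
    (c : I -> I -> R) (f : I -> R) :
  0 <= hi -> (#|I| <= n)%N -> (forall i, c i i = 0) ->
  (forall i j, i != j -> lo <= c i j <= hi) -> \sum_i f i = 0 ->
  \sum_i \sum_j c i j * f i * f j
  <= (hi * (1 - Gamma_n R n) - lo) / 2 * (\sum_i `|f i|) ^+ 2.
Proof.
move=> hi0 In c0 cb f0.
apply: (@le_trans _ _ ((hi - lo) / 2 * (\sum_i `|f i|) ^+ 2 - hi * \sum_i f i ^+ 2)).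
  rewrite -sum_majorant //; apply: ler_sum => i _; apply: ler_sum => j _.
  have [<-|ij] := eqVneq i j; last first.
    by rewrite mul0r subr0; apply: weighted_product_le; apply: cb.
  rewrite c0 !mul0r mul1r -normrM ger0_norm -?expr2 ?sqr_ge0 //.
  lra.
have := ler_wpM2l hi0 (sqr_sumr_norm_le In f0).
set T := _ ^+ 2; lra.
Qed.

(** The equality case of the termwise majorant, used to evaluate the form of the extremal space
    exactly. *)
Lemma two_valued_formE (R : realType) (I : finType) (lo hi : R)
    (c : I -> I -> R) (f : I -> R) :
  (forall i, c i i = 0) ->
  (forall i j, i != j -> c i j = if 0 <= f i * f j then hi else lo) ->
  \sum_i f i = 0 ->
  \sum_i \sum_j c i j * f i * f j
  = (hi - lo) / 2 * (\sum_i `|f i|) ^+ 2 - hi * \sum_i f i ^+ 2.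
Proof.
move=> c0 cE f0; rewrite -sum_majorant //.
apply: eq_bigr => i _; apply: eq_bigr => j _; rewrite -normrM -mulrA.
have [<-|ij] := eqVneq i j.
  by rewrite c0 !mul0r mul1r ger0_norm -?expr2 ?sqr_ge0 //; field.
by rewrite cE // mul0r subr0; case: ger0P => _; field.
Qed.

(** * Distance bounds and the negative-type form of a finite semi-metric space *)

Section SemiMetric.
Variables (R : realType) (X : finType) (d : X -> X -> R).
Hypothesis d_semi : semimetric d.

Lemma dist_gt0 x y : x != y -> 0 < d x y.
Proof.
case: d_semi => d0 dE _ xy; rewrite lt0r d0 andbT.
by apply: contra_neq xy => /dE.
Qed.

Lemma dist_powxx p x : dist_pow d p x x = 0.
Proof.
case: d_semi => _ dE _; rewrite /dist_pow eqxx.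
by case: eqVneq => // p0; rewrite (dE x x).2 // powR0.
Qed.

Lemma dist_pow_neq p x y : x != y -> dist_pow d p x y = d x y `^ p.
Proof. by move=> xy; rewrite /dist_pow xy; case: eqVneq => // ->; rewrite powRr0. Qed.

Lemma dist_le_diameter x y : d x y <= diameter d.
Proof. by apply: le_trans (le_bigmax _ _ x); apply: le_bigmax. Qed.

Lemma min_distance_le x y : x != y -> min_distance d <= d x y.
Proof.
exact: (@bigmin_le_cond _ _ _ _ (x, y) (fun xy : X * X => xy.1 != xy.2)
  (fun xy => d xy.1 xy.2)).
Qed.

Lemma exists_neq : (2 <= #|X|)%N -> exists x y : X, x != y.
Proof.
by rewrite -cardsT => /card_gt1P[x [y [_ _ xy]]]; exists x, y.
Qed.

Lemma min_distance_gt0 : (2 <= #|X|)%N -> 0 < min_distance d.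
Proof.
move=> /exists_neq[x [y xy]]; apply: lt_bigmin => [|[u v] uv]; last exact: dist_gt0.
exact: lt_le_trans (dist_gt0 xy) (dist_le_diameter _ _).
Qed.

Lemma scaled_diameter_ge1 : (2 <= #|X|)%N -> 1 <= scaled_diameter d.
Proof.
move=> X2; rewrite ler_pdivlMr ?min_distance_gt0 // mul1r.
exact: bigmin_le_id.
Qed.

(** Factoring out the power of the least distance leaves a bound whose sign depends only on the
    scaled diameter, [p] and the number of points. *)
Lemma negative_form_le p k (x : 'I_k -> X) (eta : 'I_k -> R) :
  0 <= p -> (2 <= #|X|)%N -> injective x -> \sum_i eta i = 0 ->
  negative_form d p x eta
  <= min_distance d `^ p * (scaled_diameter d `^ p * (1 - Gamma_n R #|X|) - 1) / 2
     * (\sum_i `|eta i|) ^+ 2.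
Proof.
move=> p0 X2 xinj eta0.
have m0 := min_distance_gt0 X2; have D1 := scaled_diameter_ge1 X2.
have ME : diameter d `^ p = min_distance d `^ p * scaled_diameter d `^ p.
  rewrite -powRM ?ltW //; last exact: lt_le_trans D1.
  by rewrite mulrC /scaled_diameter divfK // gt_eqF.
apply: (@le_trans _ _ ((diameter d `^ p * (1 - Gamma_n R #|X|) - min_distance d `^ p) / 2
     * (\sum_i `|eta i|) ^+ 2)); last by rewrite ME; lra.
apply: two_valued_form_le => //; first exact: powR_ge0.
- by apply: leq_card xinj.
- by move=> i; apply: dist_powxx.
- move=> i j ij; have xij : x i != x j by apply: contra_neq ij => /xinj.
  have xij0 := dist_gt0 xij; have xijM := dist_le_diameter (x i) (x j).
  by rewrite dist_pow_neq // !ge0_ler_powR ?nnegrE ?min_distance_le ?(le_trans _ xijM) // ltW.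
Qed.

End SemiMetric.

(** * Comparing an exponent with [zeta], and negative type up to it *)

Section ZetaBound.
Variables (R : realType) (n : nat) (D p : R).
Hypotheses (n3 : (3 <= n)%N) (D1 : 1 <= D).

Let inv_gt0 : 0 < 1 / (1 - Gamma_n R n).
Proof. by rewrite div1r invr_gt0 subr_gt0 Gamma_n_lt1. Qed.

(** Take logarithms when [D > 1]. When [D = 1] both sides hold: [zeta] is infinite and the
    inequality reads [1 - Gamma_n R n <= 1]. *)
Lemma le_zeta : (p%:E <= zeta n D)%E = (D `^ p * (1 - Gamma_n R n) <= 1).
Proof.
have g1 : 0 < 1 - Gamma_n R n by rewrite subr_gt0 Gamma_n_lt1.
have g0 : 0 < Gamma_n R n by rewrite Gamma_n_gt0 // ltnW.
rewrite /zeta; case: eqVneq => [->|Dn].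
  by rewrite leey powR1 mul1r; apply/esym; lra.
have Dgt : 1 < D by rewrite lt_neqAle eq_sym Dn.
have D0 : 0 < D `^ p by rewrite powR_gt0 // (lt_trans ltr01).
by rewrite lee_fin ler_pdivlMr ?ln_gt0 // -ln_powR ler_ln ?posrE // ler_pdivlMr.
Qed.

Lemma lt_zeta : (p%:E < zeta n D)%E = (D `^ p * (1 - Gamma_n R n) < 1).
Proof.
have g1 : 0 < 1 - Gamma_n R n by rewrite subr_gt0 Gamma_n_lt1.
have g0 : 0 < Gamma_n R n by rewrite Gamma_n_gt0 // ltnW.
rewrite /zeta; case: eqVneq => [->|Dn].
  by rewrite ltry powR1 mul1r; apply/esym; lra.
have Dgt : 1 < D by rewrite lt_neqAle eq_sym Dn.
have D0 : 0 < D `^ p by rewrite powR_gt0 // (lt_trans ltr01).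
by rewrite lte_fin ltr_pdivlMr ?ln_gt0 // -ln_powR ltr_ln ?posrE // ltr_pdivlMr.
Qed.
End ZetaBound.

Lemma negative_type_le_zeta (R : realType) (X : finType) (d : X -> X -> R) (p : R) :
  semimetric d -> (3 <= #|X|)%N -> 0 <= p ->
  (p%:E <= zeta #|X| (scaled_diameter d))%E -> negative_type d p.
Proof.
move=> ds X3 p0; have X2 := ltnW X3.
rewrite le_zeta ?scaled_diameter_ge1 // -subr_le0 => h k x eta _ xinj eta0.
apply: le_trans (negative_form_le ds p0 X2 xinj eta0) _.
rewrite mulr_le0_ge0 ?sqr_ge0 // pmulr_lle0 // mulr_ge0_le0 ?powR_ge0 //.
Qed.

Lemma strict_negative_type_lt_zeta (R : realType) (X : finType) (d : X -> X -> R) (p : R) :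
  semimetric d -> (3 <= #|X|)%N -> 0 <= p ->
  (p%:E < zeta #|X| (scaled_diameter d))%E -> strict_negative_type d p.
Proof.
move=> ds X3 p0 pz; have X2 := ltnW X3; split.
  by apply: negative_type_le_zeta => //; apply: ltW.
move: pz; rewrite lt_zeta ?scaled_diameter_ge1 // -subr_lt0 => h k x eta _ xinj eta0 etaN.
apply: le_lt_trans (negative_form_le ds p0 X2 xinj eta0) _.
rewrite nmulr_rlt0 ?exprn_gt0 //; last first.
  by rewrite pmulr_llt0 // pmulr_rlt0 // powR_gt0 // min_distance_gt0.
rewrite lt0r sumr_ge0 ?andbT => [|i _]; last exact: normr_ge0.
apply/negP => /eqP /psumr_eq0P eta_0; apply: etaN => i.
by apply/normr0_eq0/eta_0.
Qed.

(** * The negative type gap at exponent 0 *)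

Lemma sum_ltn_sqr (R : realType) (q : nat) (f : 'I_q -> R) :
  2 * \sum_(i < q) \sum_(j < q | (i < j)%N) f i * f j
  = (\sum_i f i) ^+ 2 - \sum_i f i ^+ 2.
Proof.
set U := \sum_(i < q) _.
have UE : U = \sum_(i < q) \sum_(j < q | (j < i)%N) f i * f j.
  rewrite /U (exchange_big_dep xpredT) //=; apply: eq_bigr => i _.
  by apply: eq_bigr => j _; rewrite mulrC.
suff -> : (\sum_i f i) ^+ 2 = U + U + \sum_i f i ^+ 2 by ring.
rewrite {1}/U UE expr2 mulr_suml -!big_split /=; apply: eq_bigr => i _.
rewrite mulr_sumr (bigD1 i) //= addrC -expr2; congr (_ + _).
rewrite (bigID (fun j : 'I_q => (i < j)%N)) /=; congr (_ + _); apply: eq_bigl => j.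
  by rewrite -val_eqE /=; lia.
by rewrite -val_eqE /=; lia.
Qed.

(** All distances between distinct points become 1, so the cross sum is the product of the total
    masses, namely 1, and each inner sum is half of 1 minus the sum of squared weights. *)
Lemma simplex_gap0 (R : realType) (X : eqType) (d : X -> X -> R) (q t : nat)
    (S : simplex R X q t) :
  simplex_gap d 0 S = (\sum_i swa S i ^+ 2 + \sum_i swb S i ^+ 2) / 2.
Proof.
have sA := sum_ltn_sqr (swa S); have sB := sum_ltn_sqr (swb S).
rewrite swa_sum1 in sA; rewrite swb_sum1 in sB.
rewrite /simplex_gap /dist_pow eqxx.
have -> : \sum_j \sum_i swa S j * swb S i * (spa S j != spb S i)%:R = 1.
  transitivity ((\sum_j swa S j) * \sum_i swb S i); last by rewrite swa_sum1 swb_sum1 mulr1.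
  rewrite mulr_suml.
  apply: eq_bigr => j _; rewrite mulr_sumr; apply: eq_bigr => i _.
  by rewrite (introN eqP (@spab_neq _ _ _ _ S _ _)) mulr1.
have pairE (q' : nat) (f : 'I_q' -> R) (x : 'I_q' -> X) : injective x ->
    \sum_(i < q') \sum_(j < q' | (i < j)%N) f i * f j * (x i != x j)%:R
    = \sum_(i < q') \sum_(j < q' | (i < j)%N) f i * f j.
  move=> xinj; apply: eq_bigr => i _; apply: eq_bigr => j ij.
  by rewrite (inj_eq xinj) -val_eqE neq_ltn ij mulr1.
rewrite (pairE _ _ _ (@spa_inj _ _ _ _ S)) (pairE _ _ _ (@spb_inj _ _ _ _ S)).
lra.
Qed.

Lemma sum_sqr_ge_inv (R : realType) (q : nat) (f : 'I_q -> R) :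
  \sum_i f i = 1 -> q%:R^-1 <= \sum_i f i ^+ 2.
Proof.
move=> f1; have := sqr_sum_le xpredT f.
by rewrite f1 expr1n cardT size_enum_ord mul1r.
Qed.

Lemma sum_sqr_uniform (R : realType) (q : nat) : (0 < q)%N ->
  \sum_(i < q) (q%:R^-1) ^+ 2 = q%:R^-1 :> R.
Proof. by move=> q0; rewrite -mulr_suml sumr_cst_inv // mul1r. Qed.

Lemma simplex_card (R : realType) (X : finType) (q t : nat) (S : simplex R X q t) :
  (q + t <= #|X|)%N.
Proof.
pose f (s : 'I_q + 'I_t) : X := match s with inl i => spa S i | inr j => spb S j end.
rewrite -(card_ord q) -(card_ord t) -card_sum; apply: (@leq_card _ _ f).
move=> [i|i] [j|j] //=.
- by move=> /(@spa_inj _ _ _ _ S) ->.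
- by move=> /(@spab_neq _ _ _ _ S).
- by move=> /esym /(@spab_neq _ _ _ _ S).
- by move=> /(@spb_inj _ _ _ _ S) ->.
Qed.

(** Provides the minimiser of the gap at exponent 0. Any distinct vertices will do, since that gap
    depends on the weights alone. *)
Lemma simplex_uniform (R : realType) (X : finType) (q t : nat) :
  (0 < q)%N -> (0 < t)%N -> (q + t <= #|X|)%N ->
  exists S : simplex R X q t,
    swa S = (fun=> q%:R^-1) /\ swb S = (fun=> t%:R^-1).
Proof.
move=> q0 t0 qtX.
pose e i : X := enum_val (widen_ord qtX i).
have e_inj : injective e by move=> i j /enum_val_inj [] /val_inj.
have aI : injective (e \o @lshift q t) := inj_comp e_inj (@lshift_inj q t).
have bI : injective (e \o @rshift q t) := inj_comp e_inj (@rshift_inj q t).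
have abN j i : (e \o @lshift q t) j <> (e \o @rshift q t) i.
  by move=> /e_inj /eqP; rewrite eq_lrshift.
have inv0 k (k0 : (0 < k)%N) (i : 'I_k) : 0 < k%:R^-1 :> R by rewrite invr_gt0 ltr0n.
by exists (Simplex aI bI abN (inv0 _ q0) (inv0 _ t0) (sumr_cst_inv R q0) (sumr_cst_inv R t0)).
Qed.


Lemma negative_type_gap0 (R : realType) (X : finType) (d : X -> X -> R) :
  (2 <= #|X|)%N -> negative_type_gap d 0 = (Gamma_n R #|X|)%:E.
Proof.
move=> X2; apply/eqP; rewrite eq_le; apply/andP; split.
  have q0 : (0 < #|X|./2)%N by lia.
  have t0 : (0 < uphalf #|X|)%N by lia.
  have qtX : (#|X|./2 + uphalf #|X| <= #|X|)%N by lia.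
  have [S [aE bE]] := simplex_uniform R q0 t0 qtX.
  apply: ereal_inf_lbound; exists #|X|./2, (uphalf #|X|), S; split => //.
  by rewrite simplex_gap0 aE bE !sum_sqr_uniform // /Gamma_n mulrC.
apply: le_ereal_inf_tmp => _ [q [t [S [q0 t0 ->]]]].
rewrite lee_fin simplex_gap0.
have := sum_sqr_ge_inv (swa_sum1 S); have := sum_sqr_ge_inv (swb_sum1 S).
have := Gamma_n_le R q0 t0 (simplex_card S); lra.
Qed.

(** * The extremal two-block space *)

Definition two_block_dist (R : realType) (a b : nat) (D : R) (x y : 'I_a + 'I_b) : R :=
  if x == y then 0 else if is_inl x == is_inl y then D else 1.

(** Masses 1 and -1 spread uniformly over the blocks: the equality case of Cauchy-Schwarz in each
    sign class. *)
Definition two_block_weight (R : realType) (a b : nat) (x : 'I_a + 'I_b) : R :=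
  if x is inl _ then a%:R^-1 else - b%:R^-1.

Section TwoBlock.
Variables (R : realType) (a b : nat) (D : R).
Hypotheses (a0 : (0 < a)%N) (b2 : (2 <= b)%N) (D1 : 1 < D).
Let d := @two_block_dist R a b D.
Let w := @two_block_weight R a b.
Let b0 : (0 < b)%N := ltnW b2.

Lemma two_block_semimetric : semimetric d.
Proof.
have D0 : 0 < D := lt_trans ltr01 D1.
split=> x y; rewrite /d /two_block_dist.
- by case: ifP => // _; case: ifP => // _; apply: ltW.
- case: eqVneq => [->|xy]; first by split.
  split=> [/eqP|xyE]; last by rewrite xyE eqxx in xy.
  by case: ifP => _; rewrite ?oner_eq0 ?gt_eqF.
- by rewrite eq_sym; case: ifP => // _; rewrite eq_sym.
Qed.

Lemma two_block_diameter : diameter d = D.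
Proof.
have D0 : 0 < D := lt_trans ltr01 D1.
apply/eqP; rewrite eq_le; apply/andP; split.
  apply: bigmax_le => [|x _]; first exact: ltW.
  apply: bigmax_le => [|y _]; first exact: ltW.
  by rewrite /d /two_block_dist; case: ifP => _; last case: ifP => _; rewrite // ltW.
(* The distance [D] is attained in the second block, since the first may be a single point; the
   ordinals here are 0 and 1. *)
pose x : 'I_a + 'I_b := inr (Ordinal b0); pose y : 'I_a + 'I_b := inr (Ordinal b2).
by have := dist_le_diameter d x y; rewrite {1}/d /two_block_dist.
Qed.

Lemma two_block_min_distance : min_distance d = 1.
Proof.
apply/eqP; rewrite eq_le; apply/andP; split.
  pose x : 'I_a + 'I_b := inl (Ordinal a0); pose y : 'I_a + 'I_b := inr (Ordinal b0).
  by have := @min_distance_le R _ d x y isT; rewrite /d /two_block_dist.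
apply: le_bigmin => [|[x y] /= xy]; first by rewrite two_block_diameter ltW.
by rewrite /d /two_block_dist (negbTE xy); case: ifP => // _; rewrite ltW.
Qed.

Lemma two_block_scaled_diameter : scaled_diameter d = D.
Proof. by rewrite /scaled_diameter two_block_diameter two_block_min_distance divr1. Qed.

Lemma sum_two_block_weight (f : R -> R) :
  \sum_x f (w x) = a%:R * f a%:R^-1 + b%:R * f (- b%:R^-1).
Proof. by rewrite big_sumType /= !sumr_const !card_ord !mulr_natl. Qed.

(** The absolute weights sum to 2 and their squares to [1/a + 1/b]; the sign of a product of weights
    tells whether two points share a block. *)
Lemma two_block_form (p : R) :
  \sum_x \sum_y dist_pow d p x y * w x * w y
  = 2 * (D `^ p * (1 - (a%:R^-1 + b%:R^-1) / 2) - 1).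
Proof.
have aN0 : a%:R != 0 :> R by rewrite pnatr_eq0 -lt0n.
have bN0 : b%:R != 0 :> R by rewrite pnatr_eq0 -lt0n.
have a1 : 0 < a%:R^-1 :> R by rewrite invr_gt0 ltr0n.
have b1 : 0 < b%:R^-1 :> R by rewrite invr_gt0 ltr0n.
rewrite (@two_valued_formE _ _ 1 (D `^ p)).
- rewrite (sum_two_block_weight (fun z => `|z|)) (sum_two_block_weight (fun z => z ^+ 2)).
  by rewrite normrN !gtr0_norm //; field; rewrite aN0 bN0.
- by move=> x; apply: (dist_powxx two_block_semimetric).
- move=> x y xy; rewrite dist_pow_neq // /d /two_block_dist (negbTE xy).
  have [] : 0 < a%:R^-1 * a%:R^-1 :> R /\ 0 < b%:R^-1 * b%:R^-1 :> R by split; apply: mulr_gt0.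
  have : 0 < a%:R^-1 * b%:R^-1 :> R by apply: mulr_gt0.
  case: x y xy => [i|i] [j|j] _ ab aa bb /=; case: ifP => //; rewrite ?powR1 //; lra.
- by rewrite (sum_two_block_weight id) mulrN !divff // subrr.
Qed.

Lemma two_block_not_negative_type (p : R) :
  1 < D `^ p * (1 - (a%:R^-1 + b%:R^-1) / 2) -> ~ negative_type d p.
Proof.
move=> h nt.
(* Negative type is tested on families indexed by ['I_k], so the whole space is enumerated and the
   sums are reindexed. *)
pose x (i : 'I_#|{: 'I_a + 'I_b}|) := enum_val i.
have X2 : (2 <= #|{: 'I_a + 'I_b}|)%N by rewrite card_sum !card_ord; lia.
have reidx (f : 'I_a + 'I_b -> R) : \sum_i f (x i) = \sum_y f y.
  by rewrite [RHS](reindex x) //; apply/onW_bij/enum_val_bij.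
have := nt _ x (w \o x) X2 (@enum_val_inj _ _).
rewrite /negative_form /= (reidx w) (sum_two_block_weight id) mulrN.
rewrite !divff ?pnatr_eq0 -?lt0n // subrr => /(_ erefl).
under eq_bigr do rewrite (reidx (fun y => dist_pow d p (x _) y * w (x _) * w y)).
rewrite (reidx (fun z => \sum_y dist_pow d p z y * w z * w y)) two_block_form; lra.
Qed.

End TwoBlock.

Lemma two_block_maximal_negative_type (R : realType) (n : nat) (D : R) :
  (3 <= n)%N -> 1 < D ->
  is_maximal_negative_type (@two_block_dist R n./2 (uphalf n) D) (zeta n D).
Proof.
move=> n3 D1.
have a0 : (0 < n./2)%N by lia.
have b2 : (2 <= uphalf n)%N by lia.
have Xn : #|{: 'I_(n./2) + 'I_(uphalf n)}| = n by rewrite card_sum !card_ord; lia.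
(* The maximum must be a real exponent: [zeta] is finite as [D] is not 1, and nonnegative by
   [le_zeta] at exponent 0. *)
have [r r0 zE] : exists2 r : R, 0 <= r & zeta n D = r%:E.
  have := le_zeta 0 n3 (ltW D1); rewrite powRr0 mul1r /zeta gt_eqF // lee_fin => rE.
  by exists (ln (1 / (1 - Gamma_n R n)) / ln D); rewrite ?rE // gerBl ltW // Gamma_n_gt0 // ltnW.
split.
  exists r => //=; split=> //; apply: negative_type_le_zeta; rewrite ?Xn //.
    exact: two_block_semimetric.
  by rewrite two_block_scaled_diameter // zE.
move=> _ [p [p0 pnt] <-]; rewrite leNgt; apply/negP => zp.
apply: (two_block_not_negative_type a0 b2 D1 _ pnt).
(* Beyond [zeta] the criterion of [le_zeta] fails, which is precisely positivity of the two-block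
   form. *)
move: zp; rewrite ltNge le_zeta // -?ltNge ?(ltW D1) //.
by rewrite /Gamma_n [2^-1 * _]mulrC.
Qed.

Theorem mainTheorem3 (R : realType) :
  (forall (X : finType) (d : X -> X -> R),
     semimetric d -> (2 <= #|X|)%N ->
     negative_type_gap d 0 = (Gamma_n R #|X|)%:E)
  /\
  (forall (X : finType) (d : X -> X -> R),
     semimetric d -> (3 <= #|X|)%N ->
     (forall p : R, 0 <= p -> (p%:E <= zeta #|X| (scaled_diameter d))%E ->
        negative_type d p) /\
     (forall p : R, 0 <= p -> (p%:E < zeta #|X| (scaled_diameter d))%E ->
        strict_negative_type d p))
  /\
  (forall (n : nat) (D : R),
     (3 <= n)%N -> 1 < D ->
     exists (X : finType) (d : X -> X -> R),
       [/\ semimetric d, #|X| = n, scaled_diameter d = D &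
           is_maximal_negative_type d (zeta n D)]).
Proof.
split; first by move=> X d _ X2; apply: negative_type_gap0.
split=> [X d ds X3|n D n3 D1].
  split=> p p0 pz; first exact: negative_type_le_zeta pz.
  exact: strict_negative_type_lt_zeta pz.
exists ('I_(n./2) + 'I_(uphalf n))%type, (@two_block_dist R n./2 (uphalf n) D); split.
- exact: two_block_semimetric.
- by rewrite card_sum !card_ord; lia.
- by apply: two_block_scaled_diameter => //; lia.
- exact: two_block_maximal_negative_type.
Qed.
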